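(* Let $H$ and $\tilde H$ be weight matrices for two sets of model parameters, $\theta$ and $\tilde\theta$ respectively, which differ by a scaling factor of $\delta$, i.e. $\tilde H=\delta H$. Let $\mu_{t,k},\sigma_{t,k}$ and $\tilde\mu_{t,k},\tilde\sigma_{t,k}$ be the Assorted-Time Normalization (ATN) mean and standard deviation at time step $t$ of the sequences $\{Ha^{(t)}\}$ and $\{\tilde Ha^{(t)}\}$ respectively, and let $y^{(t)}$ and $\tilde y^{(t)}$ be the corresponding ATN outputs. Then the outputs of ATN are the same: $$\tilde y^{(t)}=\frac{\gamma}{\tilde\sigma_{t,k}}\odot\left(\tilde Ha^{(t)}-\tilde\mu_{t,k}\right)+\beta=\frac{\gamma}{\sigma_{t,k}}\odot\left(Ha^{(t)}-\mu_{t,k}\right)+\beta=y^{(t)},$$ where $\tilde\sigma_{t,k}=\delta\sigma_{t,k}$ and $\tilde\mu_{t,k}=\delta\mu_{t,k}$.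
   Context: ATN is a normalization method for recurrent neural networks. Here $\{a^{(t)}\}$ is a sequence of vectors indexed by the time step $t$, to which the weight matrix is applied, and $Ha^{(t)}\in\mathbb{R}^n$. For a sequence $\{b^{(t)}\}\subset\mathbb{R}^n$ to be normalized and a memory length $k$, the ATN statistics at time $t$ are computed over the $k$ most recent entries: $$\mu_{t,k}=\frac{1}{nk}\sum_{j=0}^{k-1}\sum_{s=1}^{n}b_s^{(t-j)},\qquad \sigma_{t,k}^2=\frac{1}{nk}\sum_{j=0}^{k-1}\sum_{s=1}^{n}\left(b_s^{(t-j)}-\mu_{t,k}\right)^2,$$ where at early time steps, when fewer than $k$ entries exist, only the available entries are used (and their number replaces $k$). The statistics in the claim are those for $b^{(t)}=Ha^{(t)}$ and $b^{(t)}=\tilde Ha^{(t)}$. Only the current entry is normalized, and the ATN output is $\gamma\odot\frac{b^{(t)}-\mu_{t,k}}{\sqrt{\sigma_{t,k}^2+\varepsilon}}+\beta$, where $\gamma,\beta$ are trainable parameters shared across time (the same for both sets of model parameters), $\odot$ is the entrywise product, the scalar $\mu_{t,k}$ is subtracted from every component, and $\varepsilon$ is a small constant added to prevent division by zero. In the invariance property of the claim the output is written without $\varepsilon$, i.e. with denominator $\sigma_{t,k}$.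
   Formalization: The scaling factor δ is assumed positive: for δ < 0 the standard deviation scales by |δ|, so the claimed σ̃ = δσ fails whenever σ > 0, and for δ = 0 the output is undefined because σ̃ = 0. *)

(* Defs.v *)
From HB Require Import structures.
From mathcomp Require Import all_boot all_order all_algebra.
From mathcomp Require Import reals.

Set Implicit Arguments.
Unset Strict Implicit.
Unset Printing Implicit Defensive.

Import Order.TTheory GRing.Theory Num.Theory.
Local Open Scope ring_scope.

Definition hadamard (R : realType) (n : nat) (u v : 'cV[R]_n) : 'cV[R]_n :=
  map2_mx *%R u v.

(* Time steps are counted from 0, so t.+1 entries b 0, ..., b t exist at time t;
   the window has k entries, or all t.+1 of them while t.+1 < k. Since
   j < atn_len k t implies j <= t, the subtractions t - j below never truncate. *)
Definition atn_len (k t : nat) : nat := minn k t.+1.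

Definition atn_mean (R : realType) (n k : nat) (b : nat -> 'cV[R]_n) (t : nat)
    : R :=
  (n * atn_len k t)%:R^-1 *
    \sum_(j < atn_len k t) \sum_(s < n) b (t - j)%N s 0.

Definition atn_var (R : realType) (n k : nat) (b : nat -> 'cV[R]_n) (t : nat)
    : R :=
  (n * atn_len k t)%:R^-1 *
    \sum_(j < atn_len k t) \sum_(s < n)
      (b (t - j)%N s 0 - atn_mean k b t) ^+ 2.

Definition atn_std (R : realType) (n k : nat) (b : nat -> 'cV[R]_n) (t : nat)
    : R :=
  Num.sqrt (atn_var k b t).

Definition atn_output (R : realType) (n k : nat) (eps : R)
    (gamma beta : 'cV[R]_n) (b : nat -> 'cV[R]_n) (t : nat) : 'cV[R]_n :=
  hadamard gamma
    ((Num.sqrt (atn_var k b t + eps))^-1 *: (b t - const_mx (atn_mean k b t)))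
  + beta.

(* Main.v *)
Require Import Defs.
From mathcomp Require Import all_boot all_order all_algebra.
From mathcomp Require Import reals.

Set Implicit Arguments.
Unset Strict Implicit.
Unset Printing Implicit Defensive.

Import Order.TTheory GRing.Theory Num.Theory.
Local Open Scope ring_scope.

(** Multiplying [H] by [delta] multiplies every entry of the sequence by [delta]. The mean is linear
    and the variance quadratic in the entries, so [atn_mean_scale] and [atn_std_scale] give the
    factors [delta] and [|delta|], the latter being [delta] by positivity. In the output, the
    centred vector then carries a factor [delta] and the inverse deviation a factor [delta^-1], and
    these cancel. *)

Lemma atn_mean_scale (R : realType) (n k t : nat) (c : R)
    (b : nat -> 'cV[R]_n) :
  atn_mean k (fun i => c *: b i) t = c * atn_mean k b t.
Proof.
rewrite /atn_mean mulrCA; congr (_ * _); rewrite mulr_sumr.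
apply: eq_bigr => j _; rewrite mulr_sumr.
by apply: eq_bigr => s _; rewrite mxE.
Qed.

(** The mean scales along with the entries, so each deviation from it acquires exactly one factor
    [c]. *)
Lemma atn_var_scale (R : realType) (n k t : nat) (c : R)
    (b : nat -> 'cV[R]_n) :
  atn_var k (fun i => c *: b i) t = c ^+ 2 * atn_var k b t.
Proof.
rewrite /atn_var atn_mean_scale [RHS]mulrCA; congr (_ * _); rewrite mulr_sumr.
apply: eq_bigr => j _; rewrite mulr_sumr.
by apply: eq_bigr => s _; rewrite mxE -mulrBr exprMn.
Qed.

Lemma atn_std_scale (R : realType) (n k t : nat) (c : R)
    (b : nat -> 'cV[R]_n) :
  atn_std k (fun i => c *: b i) t = `|c| * atn_std k b t.
Proof. by rewrite /atn_std atn_var_scale sqrtrM ?sqr_ge0 // sqrtr_sqr. Qed.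

Lemma hadamardZl (R : realType) (n : nat) (c : R) (u v : 'cV[R]_n) :
  hadamard (c *: u) v = c *: hadamard u v.
Proof. by apply/matrixP => i j; rewrite !mxE mulrA. Qed.

Lemma hadamardZr (R : realType) (n : nat) (c : R) (u v : 'cV[R]_n) :
  hadamard u (c *: v) = c *: hadamard u v.
Proof. by apply/matrixP => i j; rewrite !mxE mulrCA. Qed.

(** Bilinearity of the entrywise product moves the scalar from the centred vector onto [gamma], the
    form displayed in the theorem. *)
Lemma atn_output0 (R : realType) (n k t : nat) (gamma beta : 'cV[R]_n)
    (b : nat -> 'cV[R]_n) :
  atn_output k 0 gamma beta b t =
  hadamard ((atn_std k b t)^-1 *: gamma) (b t - const_mx (atn_mean k b t))
  + beta.
Proof. by rewrite /atn_output addr0 hadamardZr hadamardZl. Qed.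

Theorem mainTheorem2 (R : realType) (m n k : nat) (hn : (0 < n)%N)
    (hk : (0 < k)%N) (delta : R) (hdelta : 0 < delta)
    (H Htilde : 'M[R]_(n, m)) (hH : Htilde = delta *: H)
    (a : nat -> 'cV[R]_m) (gamma beta : 'cV[R]_n) (t : nat) :
  let b : nat -> 'cV[R]_n := fun i => H *m a i in
  let btilde : nat -> 'cV[R]_n := fun i => Htilde *m a i in
  let mu := atn_mean k b t in
  let sigma := atn_std k b t in
  let mutilde := atn_mean k btilde t in
  let sigmatilde := atn_std k btilde t in
  let y := atn_output k 0 gamma beta b t in
  let ytilde := atn_output k 0 gamma beta btilde t in
  [/\ ytilde = hadamard (sigmatilde^-1 *: gamma)
                 (Htilde *m a t - const_mx mutilde) + beta,
      hadamard (sigmatilde^-1 *: gamma)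
        (Htilde *m a t - const_mx mutilde) + beta
        = hadamard (sigma^-1 *: gamma) (H *m a t - const_mx mu) + beta,
      hadamard (sigma^-1 *: gamma) (H *m a t - const_mx mu) + beta = y,
      sigmatilde = delta * sigma
    & mutilde = delta * mu].
Proof.
move=> b btilde mu sigma mutilde sigmatilde y ytilde.
have btildeE i : btilde i = delta *: b i by rewrite /btilde hH scalemxAl.
have mutildeE : mutilde = delta * mu.
  (* [btilde] agrees with the scaled sequence only pointwise, so the two means are compared summand
     by summand. *)
  rewrite /mutilde /mu -atn_mean_scale /atn_mean; congr (_ * _).
  by do 2![apply: eq_bigr => ? _]; rewrite btildeE.
have sigmatildeE : sigmatilde = delta * sigma.
  (* Positivity lets [delta] be read as [|delta|], the factor produced by the square root. *)
  rewrite -[X in X * _](gtr0_norm hdelta) -atn_std_scale /sigmatilde.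
  rewrite /atn_std /atn_var; congr (Num.sqrt (_ * _)).
  rewrite atn_mean_scale -/mu -/mutilde mutildeE.
  by do 2![apply: eq_bigr => ? _]; rewrite btildeE.
split=> //; rewrite /y /ytilde ?atn_output0 //; congr (_ + _).
rewrite -[_ *m _]/(btilde t) btildeE mutildeE sigmatildeE.
have -> : const_mx (delta * mu) = delta *: const_mx mu :> 'cV[R]_n.
  by apply/matrixP => i j; rewrite !mxE.
(* [invfM] holds for all field elements since [0^-1 = 0], so the case [sigma = 0] is covered; the
   cancellation uses only [delta != 0]. *)
rewrite -scalerBr hadamardZr !hadamardZl scalerA invfM mulrA.
by rewrite mulfV ?mul1r // gt_eqF.
Qed.
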